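(* Let $K\ge 2$, and let $\mathbb{P}^1_{\mathcal{X}},\dots,\mathbb{P}^K_{\mathcal{X}}$ be Borel probability measures on $\mathcal{X}=\mathbb{R}^\alpha$ with finite second moments. Let $\psi^m,\xi^m_\uparrow,\sigma,r^m,g^m$ ($m=1,\dots,M$) and the constants $C_{\sigma\circ g^m}$ be as follows: $\psi^m:\mathcal{X}\to\mathcal{Z}=\mathbb{R}^\gamma$ is $C_m$-Lipschitz, $\xi^m_\uparrow:\mathcal{Z}\to\mathcal{X}$ is $C_{m,\uparrow}$-Lipschitz, $\sigma:\mathcal{Z}\to\widetilde{\mathcal{Z}}\subseteq\mathcal{Z}$ is $C_\sigma$-Lipschitz, $r^m(x)=x-\xi^m_\uparrow(\psi^m(x))$, $g^m=\psi^m\circ (r^m)^{(L-1)}\circ (r^{m-1})^{(L)}\circ\cdots\circ (r^1)^{(L)}$ (with $g^1=\psi^1\circ(r^1)^{(L-1)}$), and $C_{\sigma\circ g^m}=C_\sigma C_m(1+C_mC_{m,\uparrow})^{L-1}\prod_{n=1}^{m-1}(1+C_nC_{n,\uparrow})^{L}$ (empty product equal to $1$). Set $C:=\sum_{m=1}^M\max\{(C_{\sigma\circ g^m})^2,1\}$. Then for every $\epsilon\ge 0$, $$\sum_{m=1}^M\max_{i\neq j}\widehat{\mathcal{W}}_{\epsilon,\widetilde{\mathcal{Z}}}\big((\sigma\circ g^m)_\#\mathbb{P}^i_{\mathcal{X}},(\sigma\circ g^m)_\#\mathbb{P}^j_{\mathcal{X}}\big)\le C\max_{i\neq j}\mathcal{W}_{\epsilon,\mathcal{X}}\big(\mathbb{P}^i_{\mathcal{X}},\mathbb{P}^j_{\mathcal{X}}\big),$$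 where the maxima range over $i,j\in\{1,\dots,K\}$ with $i\neq j$.
   Context: All spaces carry the Euclidean norm; $(r)^{(k)}$ is the $k$-fold composition ($(r)^{(0)}$ the identity); $f_\#\mu=\mu\circ f^{-1}$ denotes the pushforward measure. For a subset $S$ of a Euclidean space and Borel probability measures $\mu,\nu$ on $S$, let $\Pi(\mu,\nu;S)$ be the set of couplings of $\mu,\nu$, and for $\epsilon\ge0$ define the entropic regularized quadratic Wasserstein distance $$\mathcal{W}_{\epsilon,S}(\mu,\nu)=\inf_{\pi\in\Pi(\mu,\nu;S)}\int_{S\times S}\Big(\|x-y\|^2+\epsilon\log\frac{d\pi(x,y)}{d\mu(x)\,d\nu(y)}\Big)d\pi(x,y)$$ (the entropic term being $\epsilon\,\mathrm{KL}(\pi\,\|\,\mu\otimes\nu)$, taken as $+\infty$ if $\pi\not\ll\mu\otimes\nu$ and $\epsilon>0$). The Sinkhorn divergence is $\widehat{\mathcal{W}}_{\epsilon,S}(\mu,\nu)=\mathcal{W}_{\epsilon,S}(\mu,\nu)-\tfrac12\big(\mathcal{W}_{\epsilon,S}(\nu,\nu)+\mathcal{W}_{\epsilon,S}(\mu,\mu)\big)$. Here $S=\widetilde{\mathcal{Z}}$ or $S=\mathcal{X}$. *)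

(* Defs.v *)
From HB Require Import structures.
From mathcomp Require Import all_boot all_order all_algebra.
From mathcomp Require Import all_classical all_reals all_analysis.
Set Implicit Arguments. Unset Strict Implicit. Unset Printing Implicit Defensive.
Import Order.TTheory GRing.Theory Num.Theory.
Import numFieldNormedType.Exports.
Local Open Scope classical_set_scope.
Local Open Scope ring_scope.

Notation Rn R n := (g_sigma_algebraType (@open 'rV[R]_n)).

Section Defs.
Variable R : realType.

Definition sqnorm n (v : 'rV[R]_n) : R := \sum_(i < n) (v ord0 i) ^+ 2.
Definition enorm n (v : 'rV[R]_n) : R := Num.sqrt (sqnorm v).

Definition is_lipschitz a b (C : R) (f : 'rV[R]_a -> 'rV[R]_b) : Prop :=
  0 <= C /\ forall x y, enorm (f x - f y) <= C * enorm (x - y).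

Definition finite_second_moment n (P : set (Rn R n) -> \bar R) : Prop :=
  (\int[P]_x (sqnorm (x : 'rV[R]_n))%:E < +oo)%E.

Local Open Scope ereal_scope.

Definition is_density d (T : measurableType d) (pi rho : set T -> \bar R)
  (f : T -> R) : Prop :=
  measurable_fun setT f /\ (forall z, (0 <= f z)%R) /\
  forall A, measurable A -> pi A = \int[rho]_(z in A) (f z)%:E.

(* Kullback-Leibler divergence KL(pi || rho) = int f ln f d rho, where f is
   a density d pi / d rho; +oo if no density exists (ereal_inf set0 = +oo).
   Densities are rho-a.e. unique, so the infimum is the common value. *)
Definition KL d (T : measurableType d) (pi rho : set T -> \bar R) : \bar R :=
  ereal_inf [set \int[rho]_z ((f z) * ln (f z))%:E | f in is_density pi rho].

(* couplings of mu, nu on S (probability measures on the ambient product,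
   concentrated on S x S, with marginals mu and nu) *)
Definition coupling n (S : set 'rV[R]_n) (mu nu : set (Rn R n) -> \bar R)
  (pi : probability (Rn R n * Rn R n)%type R) : Prop :=
  (forall A, measurable A -> pi (fst @^-1` A) = mu A) /\
  (forall B, measurable B -> pi (snd @^-1` B) = nu B) /\
  (exists B : set (Rn R n * Rn R n)%type, measurable B /\ B `<=` (S `*` S) /\ pi B = 1).

Definition ent_cost n (eps : R) (mu nu : set (Rn R n) -> \bar R)
  (pi : probability (Rn R n * Rn R n)%type R) : \bar R :=
  \int[pi]_z (sqnorm ((z.1 : 'rV[R]_n) - z.2))%:E +
  (if eps == 0%R then 0 else eps%:E * KL pi (mu \x nu)).

Definition W_ent n (eps : R) (S : set 'rV[R]_n)
  (mu nu : set (Rn R n) -> \bar R) : \bar R :=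
  ereal_inf [set ent_cost eps mu nu pi | pi in coupling S mu nu].

Definition sinkhorn n (eps : R) (S : set 'rV[R]_n)
  (mu nu : set (Rn R n) -> \bar R) : \bar R :=
  W_ent eps S mu nu - 2^-1%:E * (W_ent eps S nu nu + W_ent eps S mu mu).

Local Close Scope ereal_scope.

(* residual maps and composed encoders (0-based index m = 0..M-1) *)
Definition resid a c (psi : nat -> 'rV[R]_a -> 'rV[R]_c)
  (xi : nat -> 'rV[R]_c -> 'rV[R]_a) (m : nat) (x : 'rV[R]_a) : 'rV[R]_a :=
  x - xi m (psi m x).

Fixpoint pre_enc a c psi xi (L : nat) (m : nat) : 'rV[R]_a -> 'rV[R]_a :=
  match m with
  | 0 => id
  | m'.+1 => fun x => iter L (@resid a c psi xi m') (@pre_enc a c psi xi L m' x)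
  end.

Definition g_enc a c psi xi (L m : nat) (x : 'rV[R]_a) : 'rV[R]_c :=
  psi m (iter L.-1 (@resid a c psi xi m) (@pre_enc a c psi xi L m x)).

Definition C_sg (Csig : R) (Cm Cup : nat -> R) (L m : nat) : R :=
  Csig * Cm m * (1 + Cm m * Cup m) ^+ L.-1 *
  \prod_(n < m) (1 + Cm n * Cup n) ^+ L.

End Defs.

(* Main.v *)
(** The entropic self-costs are nonnegative because KL divergences are, so the
    Sinkhorn divergence is at most the entropic cost.  A coupling of [mu] and
    [nu] pushed forward by [f x f] couples the images of [mu] and [nu]: its
    transport cost grows by at most the squared Lipschitz constant of [f], and
    its relative entropy does not grow, by the data processing inequality.  For
    the latter, let [h] be the density upstairs and [k] the Radon-Nikodym
    density downstairs; one integrates the tangent inequality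
    [h ln t + h - t <= h ln h] at truncations [t] of [k], and passes to the
    limit by Fatou's lemma.  Since [Ztilde] need not be Borel, the image
    coupling is shown to live on [range sigma], which is sigma-compact. *)
Require Import Defs.
From HB Require Import structures.
From mathcomp Require Import all_boot all_order all_algebra.
From mathcomp Require Import all_classical all_reals all_analysis.
From mathcomp Require Import measurable_realfun ring lra.
Set Implicit Arguments. Unset Strict Implicit. Unset Printing Implicit Defensive.
Import Order.TTheory GRing.Theory Num.Theory.
Import numFieldNormedType.Exports.
Local Open Scope classical_set_scope.
Local Open Scope ring_scope.

(** * Densities, and nonnegativity of relative entropy *)

Section KL.
Context (d : measure_display) (T : measurableType d) (R : realType).
Implicit Types (pi rho : probability T R).

(** For [h > 0] this is [h] times [ln (t / h) <= t / h - 1]; at [h = 0] it reads [- t <= 0]. *)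
Lemma ln_tangent (h t : R) : 0 <= h -> 0 < t -> h * ln t + h - t <= h * ln h.
Proof.
rewrite le_eqVlt => /predU1P[<- t0|h0 t0]; first by rewrite !mul0r; lra.
have /(@le_ln1Dx R) : -1 < t / h - 1 by rewrite ltrBDl addrN divr_gt0.
rewrite addrC subrK ln_div ?posrE// => /(ler_wpM2l (ltW h0)).
by rewrite !mulrBr mulr1 mulrCA mulfV ?gt_eqF// mulr1; lra.
Qed.

(** The tangent inequality at [t = 1]. It bounds the entropy integrand below by -1. *)
Lemma mul_ln_ge (h : R) : 0 <= h -> h - 1 <= h * ln h.
Proof. by move=> h0; have := ln_tangent h0 ltr01; rewrite ln1 mulr0 add0r. Qed.

Local Open Scope ereal_scope.

Lemma density_integral pi rho h : is_density pi rho h -> \int[rho]_x (h x)%:E = 1.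
Proof. by move=> [_ [_ <-//]]; rewrite probability_setT. Qed.

Lemma density_dominates pi rho h : is_density pi rho h -> pi `<< rho.
Proof.
move=> [mh [h0 hE]]; apply/null_content_dominatesP => A mA A0.
by rewrite hE// null_set_integral//; exact/measurable_EFinP/measurable_funTS.
Qed.

(** Change of variables is available for the Radon-Nikodym derivative, which equals [h] almost
    everywhere because both have the same integral over every measurable set. *)
Lemma ge0_integral_density pi rho h (g : T -> \bar R) : is_density pi rho h ->
  measurable_fun setT g -> (forall x, 0 <= g x) ->
  \int[pi]_x g x = \int[rho]_x (g x * (h x)%:E).
Proof.
move=> hD mg g0; have numu := density_dominates hD; have [mh [h0 hE]] := hD.
rewrite -(Radon_Nikodym_SigmaFinite.change_of_variables numu)//.
have mf : measurable_fun setT (Radon_Nikodym_SigmaFinite.f pi rho).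
  exact: measurable_int (Radon_Nikodym_SigmaFinite.f_integrable _).
apply: ae_eq_integral => //.
- exact: emeasurable_funM.
- by apply: emeasurable_funM => //; exact/measurable_EFinP.
suff : ae_eq rho setT (Radon_Nikodym_SigmaFinite.f pi rho) (EFin \o h).
  by apply: filterS => x /(_ I) /= -> _.
apply: integral_ae_eq => //.
- exact: Radon_Nikodym_SigmaFinite.f_integrable.
- exact/measurable_EFinP.
- by move=> E _ mE; rewrite -hE// -Radon_Nikodym_SigmaFinite.f_integral.
Qed.

(** The negative part of [u] is at most 1, so its integral is finite and can be cancelled, even if
    the positive part has infinite integral. The shift turns signed integrands into nonnegative
    ones, to which monotonicity and Fatou apply. *)
Lemma integral_add1 rho (u : T -> R) : measurable_fun setT u ->
  (forall x, (-1 <= u x)%R) ->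
  \int[rho]_x (u x + 1)%:E = \int[rho]_x (u x)%:E + 1.
Proof.
move=> mu u1; rewrite [in RHS]integralE.
have mU : measurable_fun setT (EFin \o u) by exact/measurable_EFinP.
have mp := measurable_funepos mU; have mn := measurable_funeneg mU.
have int1 : \int[rho]_x (cst 1 x) = 1.
  by rewrite integral_cst// mul1e; exact: probability_setT.
have nfin : \int[rho]_x (EFin \o u)^\- x \is a fin_num.
  rewrite ge0_fin_numE; last by apply: integral_ge0.
  apply: (@le_lt_trans _ _ (\int[rho]_x (cst 1) x)); last first.
    by rewrite int1 ltry.
  apply: ge0_le_integral => //.
  by move=> x _; rewrite funenegE /= ge_max !lee_fin ler01 andbT lerNl.
have : \int[rho]_x (u x + 1)%:E + \int[rho]_x (EFin \o u)^\- x =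
       \int[rho]_x (EFin \o u)^\+ x + 1.
  rewrite -[X in _ = _ + X]int1.
  rewrite -!ge0_integralD//; first last.
  - by apply/measurable_EFinP; apply: measurable_funD.
  - by move=> x _; rewrite lee_fin; have := u1 x; lra.
  apply: eq_integral => x _ /=.
  rewrite funeposE funenegE /= -!EFin_max -!EFinD; congr EFin.
  by case: (leP (u x) 0%R) => ux; case: (leP (- u x)%R 0%R); lra.
by move=> upE; rewrite addeAC -upE addeK.
Qed.

Lemma measurable_mul_ln (h : T -> R) : measurable_fun setT h ->
  measurable_fun setT (fun x => h x * ln (h x))%R.
Proof.
move=> mh; apply: measurable_funM => //.
by apply: (measurableT_comp (@measurable_ln R)).
Qed.

(** After adding 1 to both sides, [h <= h * ln h + 1] is integrated, [h] having integral 1. *)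
Lemma density_entropy_ge0 pi rho h : is_density pi rho h ->
  0 <= \int[rho]_x (h x * ln (h x))%:E.
Proof.
move=> hD; have [mh [h0 _]] := hD.
have mhl := measurable_mul_ln mh.
rewrite -(@leeD2rE _ 1)// add0e -integral_add1//; last first.
  by move=> x; have := mul_ln_ge (h0 x); have := h0 x; lra.
rewrite -(density_integral hD); apply: ge0_le_integral => //.
- by move=> x _; rewrite lee_fin.
- exact/measurable_EFinP.
- by apply/measurable_EFinP; apply: measurable_funD.
- by move=> x _; rewrite lee_fin; have := mul_ln_ge (h0 x); lra.
Qed.

Lemma KL_ge0 pi rho : 0 <= KL pi rho.
Proof.
by apply: le_ereal_inf_tmp => _ [h hD <-]; exact: density_entropy_ge0 hD.
Qed.
End KL.

(** * Existence of a density for the image measures *)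

Section data_processing.
Context (d d' : measure_display) (T : measurableType d) (T' : measurableType d').
Context (R : realType).
Implicit Types (pi rho : probability T R).
Variable F : {mfun T >-> T'}.
Local Open Scope ereal_scope.

Lemma density_distribution pi rho h : is_density pi rho h ->
  exists k, is_density (distribution pi F) (distribution rho F) k.
Proof.
move=> hD.
have dom : distribution pi F `<< distribution rho F.
  have /null_content_dominatesP D := density_dominates hD.
  apply/null_content_dominatesP => A mA; apply: D.
  by rewrite -[X in measurable X]setTI; exact: measurable_funP.
have [f [f0 ffin fi fE]] := radon_nikodym_sigma_finite dom.
(* The derivative [f] is finite everywhere, so [fine] loses nothing. *)
exists (fine \o f); split; last split.
- have mf := measurable_int _ fi.
  exact: (measurableT_comp (fine_measurable measurableT) mf).
- by move=> z; apply: fine_ge0.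
- by move=> A mA; rewrite fE//; apply: eq_integral => x _; rewrite /= fineK.
Qed.

End data_processing.

(** * Truncation to [[1/(n+1), n+1]], where [ln] is bounded by [ln (n+1)] in absolute value *)

Definition clamp (R : realType) (n : nat) (x : R) : R :=
  Num.max n.+1%:R^-1 (Num.min x n.+1%:R).

Section clamp.
Context (R : realType).
Implicit Types (x : R) (n : nat).

Lemma clamp_bounds n x : n.+1%:R^-1 <= clamp n x <= n.+1%:R.
Proof.
rewrite /clamp le_max lexx /= ge_max ge_min lexx orbT andbT.
by rewrite (@le_trans _ _ 1)// ?ler1n// invf_le1 ?ltr0n// ler1n.
Qed.

Lemma clamp_gt0 n x : 0 < clamp n x.
Proof.
have /andP[+ _] := clamp_bounds n x.
by apply: lt_le_trans; rewrite invr_gt0 ltr0n.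
Qed.

(** A lower bound uniform in [n], as Fatou's lemma requires. Three cases: no truncation leaves
    [x * ln x]; truncation up to [e] uses [x * ln e >= e * ln e]; truncation down to [N] leaves
    nonnegative terms. *)
Lemma clamp_tangent_ge n x : 0 <= x ->
  -1 <= x * ln (clamp n x) + x - clamp n x.
Proof.
move=> x0; have N1 : 1 <= n.+1%:R :> R by rewrite ler1n.
have V1 : n.+1%:R^-1 <= 1 :> R by rewrite invf_le1 ?ltr0n// ler1n.
have V0 : 0 < n.+1%:R^-1 :> R by rewrite invr_gt0 ltr0n.
rewrite /clamp; move: V1 V0; set e := _^-1; set N := _%:R in N1 * => e1 e0.
case: (leP x N) => xN; case: (leP e _) => xe.
- by have := mul_ln_ge x0; lra.
- have := ln_le0 e1; have := mul_ln_ge (ltW e0).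
  by have : (e - x) * ln e <= 0; [rewrite pmulr_rle0 ?ln_le0//; lra|lra].
- by have := mulr_ge0 x0 (ln_ge0 N1); lra.
- lra.
Qed.

(** At [x = 0] the sequence is [- 1/(n+1)]; for [x > 0] truncation eventually has no effect. *)
Lemma cvg_clamp_tangent x : 0 <= x ->
  x * ln (clamp n x) + x - clamp n x @[n --> \oo] --> x * ln x.
Proof.
rewrite le_eqVlt => /predU1P[<-|x0].
  rewrite mul0r.
  rewrite [X in X @ _ --> _](_ : _ = (fun n => - harmonic n)); last first.
    apply/funext => n; rewrite mul0r !add0r /clamp min_l ?ler0n//.
    by rewrite max_l // invr_ge0 ler0n.
  by rewrite -oppr0; apply: cvgN; exact: cvg_harmonic.
apply: cvg_near_cst; near=> n.
suff -> : clamp n x = x by rewrite addrK.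
have xn : x <= n%:R by near: n; exact: nbhs_infty_ger.
have xVn : x^-1 <= n%:R by near: n; exact: nbhs_infty_ger.
have nn : n%:R <= n.+1%:R :> R by rewrite ler_nat.
rewrite /clamp min_l; last exact: le_trans nn.
rewrite max_r // -[leRHS]invrK lef_pV2 ?posrE ?invr_gt0 ?ltr0n//.
exact: le_trans nn.
Unshelve. all: by end_near. Qed.

End clamp.

(** * Integrals involving a density *)

Section density_integrals.
Context (d : measure_display) (S : measurableType d) (R : realType).
Implicit Types (pi rho : probability S R).
Local Open Scope ereal_scope.

Lemma density_integral_affine pi rho h (t : S -> R) (c : R) :
  is_density pi rho h -> measurable_fun setT t ->
  (forall x, (0 <= t x)%R) -> (0 <= c)%R ->
  \int[rho]_x (t x + c * h x)%:E = \int[rho]_x (t x)%:E + c%:E.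
Proof.
move=> hD mt t0 c0; have [mh [h0 _]] := hD.
under eq_integral do rewrite EFinD EFinM.
rewrite ge0_integralD//.
- rewrite ge0_integralZl_EFin//.
  + by rewrite (density_integral hD) mule1.
  + by move=> x _; rewrite lee_fin.
  + exact/measurable_EFinP.
- by move=> x _; rewrite lee_fin.
- exact/measurable_EFinP.
- by move=> x _; rewrite -EFinM lee_fin mulr_ge0.
- by apply/measurable_EFinP; apply: measurable_funM.
Qed.

(** Replaces the density by the measure [pi], and integrals against [pi] can be transported along a
    map. *)
Lemma density_integral_mul_add1 pi rho h (G : S -> R) :
  is_density pi rho h -> measurable_fun setT G ->
  (forall x, (0 <= G x)%R) ->
  \int[rho]_x (G x * h x + 1)%:E = \int[pi]_x (G x)%:E + 1.
Proof.
move=> hD mG G0; have [mh [h0 _]] := hD.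
rewrite integral_add1.
- rewrite (ge0_integral_density hD)//; first exact/measurable_EFinP.
- exact: measurable_funM.
- by move=> x; rewrite (@le_trans _ _ 0%R) ?mulr_ge0//; lra.
Qed.

End density_integrals.

(** * The data processing inequality *)

Section data_processing_inequality.
Context (d d' : measure_display) (T : measurableType d) (T' : measurableType d').
Context (R : realType) (pi rho : probability T R) (F : {mfun T >-> T'}).
Variables (h : T -> R) (k : T' -> R).
Hypothesis hD : is_density pi rho h.
Hypothesis kD : is_density (distribution pi F) (distribution rho F) k.
Local Open Scope ereal_scope.

(* Integrate the tangent inequality [h ln t + h - t <= h ln h] at the point
   [t = clamp n (k (F x))], where [ln t] is bounded; adding [t + c h] to both
   sides makes every integrand nonnegative. *)
Lemma clamp_tangent_le n :
  \int[distribution rho F]_z (k z * ln (clamp n (k z)) + k z - clamp n (k z) + 1)%:E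
  <= \int[rho]_x (h x * ln (h x) + 1)%:E.
Proof.
have [mh [h0 _]] := hD; have [mk [k0 _]] := kD.
have mF : measurable_fun setT F by exact: measurable_funP.
pose t z := clamp n (k z).
have t0 z : (0 < t z)%R by exact: clamp_gt0.
have mt : measurable_fun setT t.
  by apply: measurable_maxr => //; apply: measurable_minr.
have mtF : measurable_fun setT (t \o F) by exact: measurableT_comp.
have mlt : measurable_fun setT (@ln R \o t).
  exact: (measurableT_comp (@measurable_ln R)).
have mltF : measurable_fun setT (@ln R \o t \o F) by exact: measurableT_comp.
(* Since [ln t >= - c], the function [G] is nonnegative; adding [t + c * k] to the left integrand
   gives exactly [G * k + 1]. *)
pose c : R := ln n.+1%:R.
have c0 : (0 <= c)%R by rewrite ln_ge0// ler1n.
pose G z := (ln (t z) + (c + 1))%R.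
have G0 z : (0 <= G z)%R.
  rewrite /G; suff : (- c <= ln (t z))%R by lra.
  rewrite -lnV ?posrE ?ltr0n// ler_ln ?posrE ?invr_gt0 ?ltr0n//.
  by have /andP[] := clamp_bounds n (k z).
have mG : measurable_fun setT G by apply: measurable_funD.
have mGF : measurable_fun setT (G \o F) by exact: measurableT_comp.
have tE : \int[distribution rho F]_z (t z)%:E = \int[rho]_x (t (F x))%:E.
  rewrite ge0_integral_distribution//; first exact/measurable_EFinP.
  by move=> z; rewrite lee_fin ltW.
have GE : \int[distribution pi F]_z (G z)%:E = \int[pi]_x (G (F x))%:E.
  by rewrite ge0_integral_distribution//; exact/measurable_EFinP.
(* The added terms must have a finite integral for the addition to be reversible; here
   [t <= n+1]. *)
have tfin : \int[rho]_x (t (F x))%:E \is a fin_num.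
  rewrite ge0_fin_numE; last by apply: integral_ge0 => x _; rewrite lee_fin ltW.
  apply: (@le_lt_trans _ _ (\int[rho]_x (cst n.+1%:R%:E x))).
    apply: ge0_le_integral => //.
    - by move=> x _; rewrite lee_fin ltW.
    - exact/measurable_EFinP.
    - by move=> x _; rewrite lee_fin; have /andP[] := clamp_bounds n (k (F x)).
  rewrite integral_cst// [X in _ * X](_ : _ = 1) ?mule1 ?ltry//.
  exact: probability_setT.
have ufin : \int[rho]_x (t (F x))%:E + c%:E \is a fin_num by rewrite fin_numD tfin.
rewrite -(leeD2rE _ _ ufin) -{1}tE -(density_integral_affine kD mt)//; last first.
  by move=> z; exact: ltW.
rewrite -ge0_integralD//; first last.
- by apply/measurable_EFinP; apply: measurable_funD => //; apply: measurable_funM.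
- by move=> z _; rewrite lee_fin addr_ge0 ?mulr_ge0// ltW.
- apply/measurable_EFinP; apply: measurable_funD => //; apply: measurable_funB => //.
  by apply: measurable_funD => //; apply: measurable_funM.
- by move=> z _; rewrite lee_fin; have := clamp_tangent_ge n (k0 z); lra.
rewrite [leLHS](_ : _ = \int[distribution rho F]_z (G z * k z + 1)%:E); last first.
  by apply: eq_integral => z _; rewrite -EFinD; congr EFin; rewrite /G /t; ring.
(* The passage between the two spaces: [G * k] under the image of [rho] becomes [G] under the image
   of [pi], then [G \o F] under [pi], then [(G \o F) * h] under [rho]. *)
rewrite (density_integral_mul_add1 kD)// GE -(density_integral_mul_add1 hD mGF (fun x => G0 (F x))).
rewrite -(density_integral_affine hD mtF (fun x => ltW (t0 (F x))) c0).
have mhl := measurable_mul_ln mh.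
have hl1 x : (-1 <= h x * ln (h x))%R by have := mul_ln_ge (h0 x); have := h0 x; lra.
rewrite -ge0_integralD//; first last.
- by apply/measurable_EFinP; apply: measurable_funD => //; apply: measurable_funM.
- by move=> z _; rewrite lee_fin addr_ge0 ?mulr_ge0//; exact/ltW/t0.
- by apply/measurable_EFinP; apply: measurable_funD.
- by move=> z _; rewrite lee_fin; have := hl1 z; lra.
apply: ge0_le_integral => //.
- by move=> z _; rewrite lee_fin addr_ge0// mulr_ge0//; exact: G0.
- by apply/measurable_EFinP; apply: measurable_funD => //; apply: measurable_funM.
- apply/measurable_EFinP; apply: measurable_funD; first exact: measurable_funD.
  by apply: measurable_funD => //; apply: measurable_funM.
- move=> x _; rewrite -EFinD lee_fin /G /=.
  by have := ln_tangent (h0 x) (t0 (F x)); lra.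
Qed.

Lemma entropy_distribution_le :
  \int[distribution rho F]_z (k z * ln (k z))%:E <= \int[rho]_x (h x * ln (h x))%:E.
Proof.
have [mh [h0 _]] := hD; have [mk [k0 _]] := kD.
have mt n : measurable_fun setT (fun z => clamp n (k z)).
  by apply: measurable_maxr => //; apply: measurable_minr.
have mhl := measurable_mul_ln mh; have mkl := measurable_mul_ln mk.
have hl1 x : (-1 <= h x * ln (h x))%R by have := mul_ln_ge (h0 x); have := h0 x; lra.
have kl1 z : (-1 <= k z * ln (k z))%R by have := mul_ln_ge (k0 z); have := k0 z; lra.
rewrite -(@leeD2rE _ 1)// -!integral_add1//.
pose f n z := (k z * ln (clamp n (k z)) + k z - clamp n (k z) + 1)%:E.
(* The truncated integrands converge pointwise, so the limit integrand is their lower limit. *)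
rewrite (_ : \int[_]_z _ = \int[distribution rho F]_z (limn_einf (f ^~ z))); last first.
  apply: eq_integral => z _.
  have fz : f ^~ z @ \oo --> (k z * ln (k z) + 1)%:E.
    apply: cvg_EFin; first by apply: nearW.
    by apply: cvgD; [exact: cvg_clamp_tangent|exact: cvg_cst].
  by rewrite is_cvg_limn_einfE; [apply/esym/cvg_lim|apply/cvg_ex; eexists; exact: fz].
apply: le_trans; first apply: fatou => //.
- move=> n; apply/measurable_EFinP; apply: measurable_funD => //.
  apply: measurable_funB => //; apply: measurable_funD => //.
  by apply: measurable_funM => //; apply: (measurableT_comp (@measurable_ln R)).
- by move=> n z _; rewrite lee_fin; have := clamp_tangent_ge n (k0 z); lra.
(* Each tail infimum is at most its first term, which the truncated inequality bounds. *)
rewrite limn_einf_lim; apply: lime_le; first exact: is_cvg_einfs.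
apply: nearW => n; apply: le_trans (clamp_tangent_le n).
by apply: ereal_inf_lbound; exists n => /=.
Qed.

End data_processing_inequality.

(** Each density upstairs yields one downstairs of no larger entropy; if there is none upstairs, the
    bound is [+oo]. *)
Lemma KL_distribution_le (d d' : measure_display) (T : measurableType d)
    (T' : measurableType d') (R : realType) (pi rho : probability T R)
    (F : {mfun T >-> T'}) :
  (KL (distribution pi F) (distribution rho F) <= KL pi rho)%E.
Proof.
apply: le_ereal_inf_tmp => _ [h hD <-].
have [k kD] := density_distribution F hD.
apply: le_trans (entropy_distribution_le hD kD).
by apply: ereal_inf_lbound; exists k.
Qed.

(** * The Euclidean norm and its comparison with the maximum norm *)

Section euclidean_norm.
Context (R : realType).

Lemma sqnorm_ge0 n (v : 'rV[R]_n) : 0 <= sqnorm v.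
Proof. by apply: sumr_ge0 => i _; exact: sqr_ge0. Qed.

Lemma enorm_ge0 n (v : 'rV[R]_n) : 0 <= enorm v.
Proof. exact: sqrtr_ge0. Qed.

Lemma sqr_enorm n (v : 'rV[R]_n) : enorm v ^+ 2 = sqnorm v.
Proof. by rewrite sqr_sqrtr ?sqnorm_ge0. Qed.

Lemma enormN n (v : 'rV[R]_n) : enorm (- v) = enorm v.
Proof. by congr Num.sqrt; apply: eq_bigr => i _; rewrite mxE sqrrN. Qed.

Lemma le_sqnorm_coord n (v : 'rV[R]_n) i : v ord0 i ^+ 2 <= sqnorm v.
Proof. by rewrite /sqnorm (bigD1 i)//= lerDl sumr_ge0// => j _; exact: sqr_ge0. Qed.

Lemma enorm_eq0 n (v : 'rV[R]_n) : enorm v = 0 -> v = 0.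
Proof.
move=> v0; apply/rowP => i; rewrite mxE; apply/eqP; rewrite -sqrf_eq0.
by rewrite eq_le sqr_ge0 andbT (le_trans (le_sqnorm_coord v i))// -sqr_enorm v0 expr0n.
Qed.

Lemma cauchy_schwarz n (u v : 'rV[R]_n) :
  \sum_(i < n) u ord0 i * v ord0 i <= enorm u * enorm v.
Proof.
have [u0|u0] := eqVneq (enorm u) 0.
  by rewrite u0 mul0r (enorm_eq0 u0) big1// => i _; rewrite mxE mul0r.
have [v0|v0] := eqVneq (enorm v) 0.
  by rewrite v0 mulr0 (enorm_eq0 v0) big1// => i _; rewrite mxE mulr0.
set a := enorm u in u0 *; set b := enorm v in v0 *.
have ab : 0 < a * b by rewrite mulr_gt0// lt_neqAle eq_sym ?u0 ?v0 enorm_ge0.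
(* With [a] and [b] the norms of [u] and [v], expanding gives [2 * (a * b) ^+ 2 - 2 * (a * b) * <u,
   v> >= 0], to be divided by [2 * (a * b)]. *)
have : 0 <= \sum_(i < n) (b * u ord0 i - a * v ord0 i) ^+ 2.
  by apply: sumr_ge0 => i _; exact: sqr_ge0.
have -> : \sum_(i < n) (b * u ord0 i - a * v ord0 i) ^+ 2 =
   b ^+ 2 * sqnorm u + a ^+ 2 * sqnorm v -
   2 * (a * b) * \sum_(i < n) u ord0 i * v ord0 i.
  rewrite !mulr_sumr -big_split -sumrB; apply: eq_bigr => i _ /=; ring.
rewrite -!sqr_enorm -/a -/b => S0.
by rewrite -(ler_pM2l ab); lra.
Qed.

Lemma ler_enormD n (u v : 'rV[R]_n) : enorm (u + v) <= enorm u + enorm v.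
Proof.
rewrite -ler_sqr ?nnegrE ?addr_ge0 ?enorm_ge0// sqr_enorm.
have -> : sqnorm (u + v) =
    sqnorm u + sqnorm v + 2 * \sum_(i < n) u ord0 i * v ord0 i.
  rewrite /sqnorm mulr_sumr -!big_split; apply: eq_bigr => i _ /=.
  by rewrite mxE; ring.
by rewrite -!sqr_enorm; have := cauchy_schwarz u v; lra.
Qed.

(** The norm [|v|], which induces the topology on row vectors, is the maximum of the absolute values
    of the entries. *)
Lemma mx_coord_le_norm n (v : 'rV[R]_n) i : `|v ord0 i| <= `|v|.
Proof. by rewrite [leRHS]/Num.Def.normr/= mx_normrE; exact: (le_bigmax _ _ (ord0, i)). Qed.

Lemma norm_le_enorm n (v : 'rV[R]_n) : `|v| <= enorm v.
Proof.
rewrite [leLHS]/Num.Def.normr/= mx_normrE; apply: bigmax_le; first exact: enorm_ge0.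
move=> [i j] _ /=; rewrite (ord1 i) -ler_sqr ?nnegrE ?enorm_ge0// sqr_enorm.
by rewrite -normrX ger0_norm ?sqr_ge0// le_sqnorm_coord.
Qed.

(** The sharp constant [sqrt n] is relaxed to [n], by [n <= n ^ 2]. *)
Lemma enorm_le_norm n (v : 'rV[R]_n) : enorm v <= n%:R * `|v|.
Proof.
rewrite -ler_sqr ?nnegrE ?mulr_ge0 ?enorm_ge0// sqr_enorm.
apply: (@le_trans _ _ (\sum_(i < n) `|v| ^+ 2)).
  apply: ler_sum => i _; rewrite -[leLHS]ger0_norm ?sqr_ge0// normrX.
  by rewrite ler_sqr ?nnegrE// mx_coord_le_norm.
rewrite sumr_const card_ord exprMn -[leLHS]mulr_natl ler_wpM2r ?sqr_ge0//.
by rewrite -natrX ler_nat; case: n {v} => // n; rewrite expnS leq_pmulr.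
Qed.

End euclidean_norm.

(** * Lipschitz constants of the encoders *)

Section lipschitz.
Context (R : realType).

Lemma is_lipschitz_id a : is_lipschitz 1 (@id 'rV[R]_a).
Proof. by split => // x y; rewrite mul1r. Qed.

Lemma is_lipschitz_comp a b c (f : 'rV[R]_b -> 'rV[R]_c) (g : 'rV[R]_a -> 'rV[R]_b)
    Cf Cg : is_lipschitz Cf f -> is_lipschitz Cg g -> is_lipschitz (Cf * Cg) (f \o g).
Proof.
move=> [Cf0 fL] [Cg0 gL]; split; first exact: mulr_ge0.
by move=> x y /=; apply: le_trans (fL _ _) _; rewrite -mulrA ler_wpM2l.
Qed.

Lemma is_lipschitz_iter a (f : 'rV[R]_a -> 'rV[R]_a) C n :
  is_lipschitz C f -> is_lipschitz (C ^+ n) (iter n f).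
Proof.
move=> fL; elim: n => [|n ih]; first by rewrite expr0; exact: is_lipschitz_id.
by rewrite exprS; exact: is_lipschitz_comp fL ih.
Qed.

Lemma is_lipschitz_resid a c (psi : nat -> 'rV[R]_a -> 'rV[R]_c) xi m Cpsi Cxi :
  is_lipschitz Cpsi (psi m) -> is_lipschitz Cxi (xi m) ->
  is_lipschitz (1 + Cpsi * Cxi) (resid psi xi m).
Proof.
move=> pL xL; have [D0 D] := is_lipschitz_comp xL pL; rewrite mulrC in D0 D.
split; first by rewrite addr_ge0.
move=> x y; rewrite /resid opprD addrACA -opprD.
apply: le_trans (ler_enormD _ _) _.
by rewrite enormN mulrDl mul1r lerD2l; exact: D.
Qed.

Lemma is_lipschitz_pre_enc a c (psi : nat -> 'rV[R]_a -> 'rV[R]_c) xi Cm Cup L m :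
  (forall i, (i < m)%N -> is_lipschitz (Cm i) (psi i)) ->
  (forall i, (i < m)%N -> is_lipschitz (Cup i) (xi i)) ->
  is_lipschitz (\prod_(n < m) (1 + Cm n * Cup n) ^+ L) (pre_enc psi xi L m).
Proof.
elim: m => [|m ih] pL xL; first by rewrite big_ord0; exact: is_lipschitz_id.
rewrite big_ord_recr /= mulrC; apply: is_lipschitz_comp.
  by apply/is_lipschitz_iter/is_lipschitz_resid; [exact: pL|exact: xL].
by apply: ih => i im; [apply: pL|apply: xL]; exact: ltnW.
Qed.

Lemma is_lipschitz_enc a c (psi : nat -> 'rV[R]_a -> 'rV[R]_c) xi
    (sigma : 'rV[R]_c -> 'rV[R]_c) Csig Cm Cup L m :
  (forall i, (i <= m)%N -> is_lipschitz (Cm i) (psi i)) ->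
  (forall i, (i <= m)%N -> is_lipschitz (Cup i) (xi i)) ->
  is_lipschitz Csig sigma ->
  is_lipschitz (C_sg Csig Cm Cup L m) (sigma \o g_enc psi xi L m).
Proof.
move=> pL xL sL; rewrite /C_sg -!mulrA; apply: is_lipschitz_comp sL _.
apply: is_lipschitz_comp (pL m _) _ => //; apply: is_lipschitz_comp.
  by apply/is_lipschitz_iter/is_lipschitz_resid; [exact: pL|exact: xL].
by apply: is_lipschitz_pre_enc => i im; [apply: pL|apply: xL]; exact: ltnW.
Qed.

Lemma is_lipschitz_continuous a b (f : 'rV[R]_a -> 'rV[R]_b) C :
  is_lipschitz C f -> continuous f.
Proof.
move=> [C0 fL] x; apply/(@cvgrPdist_le _ _ _ (nbhs x) (nbhs_filter x) f) => e e0.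
(* The summand 1 keeps the constant positive when [C] or [a] is 0, so that [e] can be divided by
   it. *)
have D0 : 0 < C * a%:R + 1 by rewrite ltr_wpDl// mulr_ge0.
near=> y; apply: le_trans (norm_le_enorm _) _; apply: le_trans (fL _ _) _.
apply: (@le_trans _ _ ((C * a%:R + 1) * `|x - y|)).
  rewrite mulrDl mul1r -mulrA (@le_trans _ _ (C * (a%:R * `|x - y|)))//.
    by rewrite ler_wpM2l// enorm_le_norm.
  by rewrite lerDl.
rewrite mulrC -ler_pdivlMr//; near: y.
by apply: (@cvgr_dist_le _ _ _ _ _ id x); [exact: cvg_id|exact: divr_gt0].
Unshelve. all: by end_near. Qed.

End lipschitz.

(** * Borel measurability *)

Section borel.
Context (R : realType).

Lemma open_Rn_measurable n (A : set 'rV[R]_n) : open A -> measurable (A : set (Rn R n)).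
Proof. exact: sub_sigma_algebra. Qed.

Lemma closed_Rn_measurable n (A : set 'rV[R]_n) :
  closed A -> measurable (A : set (Rn R n)).
Proof.
move=> cA; rewrite -[A]setCK; apply: measurableC.
by apply: open_Rn_measurable; rewrite openC.
Qed.

Lemma continuous_Rn_measurable a b (f : 'rV[R]_a -> 'rV[R]_b) :
  continuous f -> measurable_fun setT (f : Rn R a -> Rn R b).
Proof.
move=> /continuousP cf; apply: (@measurability _ _ (Rn R a) (Rn R b) setT f (@open 'rV[R]_b)) => //.
by move=> _ [B oB <-]; rewrite setTI; apply: open_Rn_measurable; exact: cf.
Qed.

Lemma measurable_coord n i : measurable_fun setT (fun v : Rn R n => (v : 'rV[R]_n) ord0 i).
Proof.
apply: (measurability (@RGenOpens.G R)); first exact: RGenOpens.measurableE.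
move=> _ [_ [x [y ->]] <-]; rewrite setTI; apply: open_Rn_measurable.
by have /continuousP := @coord_continuous R 1 n ord0 i; apply; exact: interval_open.
Qed.

(** The domain is a countable union of compact cubes [K n]; their images are compact, hence closed,
    hence Borel. *)
Lemma measurable_range_continuous a b (f : 'rV[R]_a -> 'rV[R]_b) :
  continuous f -> measurable (range f : set (Rn R b)).
Proof.
move=> cf.
pose K (n : nat) := [set v : 'rV[R]_a | forall i, `[(- n%:R : R), n%:R]%classic (v ord0 i)].
have -> : range f = \bigcup_n (f @` K n).
  apply/seteqP; split => [_ [v _ <-]|_ [n _ [v _ <-]]]; last by exists v.
  exists (Num.truncn `|v|).+1 => //; exists v => // i /=.
  rewrite in_itv /= -ler_norml (le_trans (mx_coord_le_norm _ _))//.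
  by rewrite ltW// truncnS_gt.
apply: bigcup_measurable => n _; apply: closed_Rn_measurable.
apply: compact_closed; first exact: norm_hausdorff.
apply: continuous_compact; first exact: continuous_subspaceT.
by apply: (@rV_compact R a (fun=> `[(- n%:R : R), n%:R]%classic)) => i; exact: segment_compact.
Qed.

End borel.

(** * Products of probability measures *)

Section product_probability.
Context (d1 d2 : measure_display) (T1 : measurableType d1) (T2 : measurableType d2).
Context (R : realType) (P1 : probability T1 R) (P2 : probability T2 R).
Local Open Scope ereal_scope.

Let product_setT : (P1 \x P2) [set: T1 * T2] = 1.
Proof.
rewrite -setXTT product_measure1E// -[RHS]mule1.
by congr (_ * _); exact: probability_setT.
Qed.

(** Lets the results on [KL] take [mu \x nu] as reference probability. *)
HB.instance Definition _ :=
  Measure_isProbability.Build _ _ _ (P1 \x P2) product_setT.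

End product_probability.

(** [KL] sees its reference only through integrals, which depend only on the values at measurable
    sets. It serves to replace a product of images by the image of a product. *)
Lemma eq_measure_KL (d : measure_display) (T : measurableType d) (R : realType)
    (pi : set T -> \bar R) (rho1 rho2 : {measure set T -> \bar R}) :
  (forall A, measurable A -> rho1 A = rho2 A) -> KL pi rho1 = KL pi rho2.
Proof.
move=> rhoE.
have intE f A : measurable A -> (\int[rho1]_(z in A) f z = \int[rho2]_(z in A) f z)%E.
  by move=> mA; apply: eq_measure_integral => B mB _; exact: rhoE.
congr ereal_inf; apply/seteqP; split => _ [f [mf [f0 fE]] <-]; exists f.
- by split => //; split => // A mA; rewrite fE// intE.
- by rewrite intE.
- by split => //; split => // A mA; rewrite fE// intE.
- by rewrite intE.
Qed.

(** * Entropic costs and their behaviour under pushforward *)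

Section entropic_cost.
Context (R : realType).
Local Open Scope ereal_scope.

Lemma measurable_sqdist n :
  measurable_fun setT (fun z : Rn R n * Rn R n => sqnorm ((z.1 : 'rV[R]_n) - z.2)).
Proof.
apply: measurable_sum => i; apply: measurable_funX.
have -> : (fun z : Rn R n * Rn R n => ((z.1 : 'rV[R]_n) - z.2)%R ord0 i) =
    (fun z => (z.1 : 'rV[R]_n) ord0 i - (z.2 : 'rV[R]_n) ord0 i)%R.
  by apply/funext => z; rewrite !mxE.
apply: measurable_funB; apply: (measurableT_comp (@measurable_coord R n i)).
  exact: measurable_fst.
exact: measurable_snd.
Qed.

Lemma entropic_term_ge0 n eps (mu nu : probability (Rn R n) R)
    (pi : probability (Rn R n * Rn R n)%type R) : (0 <= eps)%R ->
  0 <= if eps == 0%R then 0 else eps%:E * KL pi (mu \x nu).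
Proof.
move=> e0; case: ifP => // _.
by rewrite mule_ge0//; exact: (KL_ge0 pi (mu \x nu : probability _ _)).
Qed.

Lemma W_ent_ge0 n eps S (mu nu : probability (Rn R n) R) : (0 <= eps)%R ->
  0 <= W_ent eps S mu nu.
Proof.
move=> e0; apply: le_ereal_inf_tmp => _ [pi _ <-].
apply: adde_ge0; last exact: entropic_term_ge0.
by apply: integral_ge0 => z _; rewrite lee_fin sqnorm_ge0.
Qed.

Lemma sinkhorn_le n eps S (mu nu : probability (Rn R n) R) : (0 <= eps)%R ->
  sinkhorn eps S mu nu <= W_ent eps S mu nu.
Proof.
move=> e0; apply: geeDl; rewrite oppe_le0.
by rewrite mule_ge0 ?lee_fin// adde_ge0// W_ent_ge0.
Qed.

Section pushforward.
Variables (a b : nat) (f : {mfun Rn R a >-> Rn R b}).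

Definition map_pair (z : Rn R a * Rn R a) : Rn R b * Rn R b := (f z.1, f z.2).

Lemma measurable_map_pair : measurable_fun setT map_pair.
Proof.
by apply: measurable_fun_pair; apply: measurableT_comp.
Qed.

HB.instance Definition _ := isMeasurableFun.Build _ _ _ _ map_pair measurable_map_pair.

(** The substitution [x := f x] in the outer integral of section measures; the sections of a
    preimage under [map_pair] are preimages of sections under [f]. *)
Lemma product_distribution (mu nu : probability (Rn R a) R) A : measurable A ->
  (distribution mu f \x distribution nu f) A = distribution (mu \x nu) map_pair A.
Proof.
move=> mA; rewrite /product_measure1 ge0_integral_distribution//.
exact: (measurable_fun_xsection (distribution nu f)).
Qed.

Lemma KL_map_pair_le (mu nu : probability (Rn R a) R) pi :
  KL (distribution pi map_pair) (distribution mu f \x distribution nu f) <=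
  KL pi (mu \x nu).
Proof.
rewrite (@eq_measure_KL _ _ _ _ (distribution mu f \x distribution nu f)
  (distribution (mu \x nu) map_pair)); last exact: product_distribution.
exact: KL_distribution_le.
Qed.

(** [S] may fail to be measurable, so a Borel set [B] between the range of [f] and [S] provides the
    set [B x B] of full mass. *)
Lemma coupling_map_pair (mu nu : probability (Rn R a) R) pi (S B : set (Rn R b)) :
  measurable B -> B `<=` S -> (forall x, B (f x)) ->
  coupling setT mu nu pi ->
  coupling S (distribution mu f) (distribution nu f) (distribution pi map_pair).
Proof.
move=> mB BS fB [piL [piR _]]; split; last split.
- move=> A mA; rewrite /distribution /pushforward -piL//.
  by rewrite -[X in measurable X]setTI; exact: measurable_funP.
- move=> A mA; rewrite /distribution /pushforward -piR//.
  by rewrite -[X in measurable X]setTI; exact: measurable_funP.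
- exists (B `*` B); split; first exact: measurableX.
  split; first by move=> [x y] [/BS ? /BS].
  rewrite -(probability_setT pi); change (pi (map_pair @^-1` (B `*` B)) = pi setT).
  congr (pi _).
  by apply/seteqP; split => // z _; split; exact: fB.
Qed.

(** The transport part is multiplied by at most [C ^+ 2] and the entropic part by at most 1; the
    maximum covers both. *)
Lemma ent_cost_map_pair_le (C eps : R) (mu nu : probability (Rn R a) R) pi :
  is_lipschitz C f -> (0 <= eps)%R ->
  ent_cost eps (distribution mu f) (distribution nu f) (distribution pi map_pair)
  <= (Num.max (C ^+ 2) 1)%:E * ent_cost eps mu nu pi.
Proof.
move=> [C0 fL] e0; set c := Num.max _ _.
have c1 : (1 <= c)%R by rewrite le_max lexx orbT.
have c0 : (0 <= c)%R by rewrite (le_trans ler01).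
have cost0 n (z : Rn R n * Rn R n) : 0 <= (sqnorm ((z.1 : 'rV[R]_n) - z.2))%:E.
  by rewrite lee_fin sqnorm_ge0.
have mcost n := @measurable_sqdist n.
rewrite /ent_cost ge0_muleDr//; last 2 first.
- exact: integral_ge0.
- exact: entropic_term_ge0.
apply: leeD; last first.
  apply: (@le_trans _ _ (if eps == 0%R then 0 else eps%:E * KL pi (mu \x nu))).
    by case: ifP => // _; rewrite lee_wpmul2l ?lee_fin// KL_map_pair_le.
  by rewrite lee_pemull ?lee_fin// entropic_term_ge0.
rewrite ge0_integral_distribution//; last exact/measurable_EFinP.
rewrite -ge0_integralZl_EFin//; last exact/measurable_EFinP.
apply: ge0_le_integral => //.
- by move=> z _; exact: (cost0 _ (map_pair z)).
- by apply/measurable_EFinP; apply: (measurableT_comp (mcost b)).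
- by apply/measurable_EFinP; apply: measurable_funM.
- move=> z _; rewrite -EFinM lee_fin /= -!sqr_enorm.
  apply: (@le_trans _ _ ((C * enorm ((z.1 : 'rV[R]_a) - z.2)) ^+ 2)%R).
    by rewrite ler_sqr ?nnegrE ?mulr_ge0 ?enorm_ge0.
  by rewrite exprMn ler_wpM2r ?sqr_ge0// le_max lexx.
Qed.

Lemma W_ent_distribution_le (C eps : R) (mu nu : probability (Rn R a) R)
    (S B : set (Rn R b)) :
  is_lipschitz C f -> (0 <= eps)%R ->
  measurable B -> B `<=` S -> (forall x, B (f x)) ->
  W_ent eps S (distribution mu f) (distribution nu f)
  <= (Num.max (C ^+ 2) 1)%:E * W_ent eps setT mu nu.
Proof.
move=> fL e0 mB BS fB.
have c0 : (0 < Num.max (C ^+ 2) 1)%R by rewrite lt_max ltr01 orbT.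
(* The positive constant is moved across so that the right side is a bare infimum, then moved back
   for a fixed coupling. *)
rewrite -lee_pdivrMl//; apply: le_ereal_inf_tmp => _ [pi piC <-].
rewrite lee_pdivrMl//; apply: le_trans (ent_cost_map_pair_le mu nu pi fL e0).
apply: ereal_inf_lbound; exists (distribution pi map_pair) => //.
exact: (coupling_map_pair mB BS fB piC).
Qed.

End pushforward.
End entropic_cost.

(** * Summation over the levels and maxima over pairs of domains *)

Theorem theorem1 (R : realType) (alpha gamma K M L : nat)
  (P : 'I_K -> probability (Rn R alpha) R)
  (psi : nat -> 'rV[R]_alpha -> 'rV[R]_gamma)
  (xi : nat -> 'rV[R]_gamma -> 'rV[R]_alpha)
  (sigma : 'rV[R]_gamma -> 'rV[R]_gamma) (Ztilde : set 'rV[R]_gamma)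
  (Cm Cup : nat -> R) (Csig : R) (eps : R) :
  (2 <= K)%N -> (1 <= L)%N ->
  (forall i, finite_second_moment (P i)) ->
  (forall m, (m < M)%N -> is_lipschitz (Cm m) (psi m)) ->
  (forall m, (m < M)%N -> is_lipschitz (Cup m) (xi m)) ->
  is_lipschitz Csig sigma -> (forall z, Ztilde (sigma z)) ->
  0 <= eps ->
  let C := \sum_(m < M) Num.max ((C_sg Csig Cm Cup L m) ^+ 2) 1 in
  (\sum_(m < M)
     \big[Order.max/-oo]_(ij : 'I_K * 'I_K | ij.1 != ij.2)
       sinkhorn eps Ztilde
         (pushforward (P ij.1) ((sigma \o g_enc psi xi L m) : Rn R alpha -> Rn R gamma))
         (pushforward (P ij.2) ((sigma \o g_enc psi xi L m) : Rn R alpha -> Rn R gamma))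
   <= C%:E * \big[Order.max/-oo]_(ij : 'I_K * 'I_K | ij.1 != ij.2)
               W_ent eps [set: 'rV[R]_alpha] (P ij.1) (P ij.2))%E.
Proof.
move=> _ _ _ psiL xiL sigmaL sigmaZ eps0; cbv zeta.
(* [C] is a sum of nonnegative terms, so it distributes over the maximum and the claim splits into
   one inequality per [m]. *)
rewrite -sumEFin ge0_sume_distrl; last first.
  by move=> m _; rewrite lee_fin le_max ler01 orbT.
apply: lee_sum => m _; apply: bigmax_le => [|[i j] /= ij]; first exact: leNye.
have fL : is_lipschitz (C_sg Csig Cm Cup L m) (sigma \o g_enc psi xi L m).
  by apply: is_lipschitz_enc => // n nm; [apply: psiL|apply: xiL];
    exact: leq_ltn_trans nm (ltn_ord m).
have mf := continuous_Rn_measurable (is_lipschitz_continuous fL).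
(* Bundling the encoder makes the pushforwards of the statement convertible to
   [distribution (P i) f]. *)
pose f : {mfun Rn R alpha >-> Rn R gamma} :=
  HB.pack ((sigma \o g_enc psi xi L m) : Rn R alpha -> Rn R gamma)
    (isMeasurableFun.Build _ _ _ _ _ mf).
apply: (le_trans (sinkhorn_le Ztilde (distribution (P i) f) (distribution (P j) f) eps0)).
apply: (@le_trans _ _ ((Num.max (C_sg Csig Cm Cup L m ^+ 2) 1)%:E *
    W_ent eps [set: 'rV[R]_alpha] (P i) (P j))%E).
  (* [range sigma] is the Borel set lying in [Ztilde] and containing all values of [f]. *)
  apply: (@W_ent_distribution_le R alpha gamma f _ _ _ _ _ (range sigma)) => //.
  - exact: measurable_range_continuous (is_lipschitz_continuous sigmaL).
  - by move=> _ [z _ <-].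
apply: lee_wpmul2l; first by rewrite lee_fin le_max ler01 orbT.
exact: (le_bigmax_cond _ (fun ij : 'I_K * 'I_K => W_ent eps setT (P ij.1) (P ij.2)) (j := (i, j))).
Qed.
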